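(* Let $m\geq1$ and $t\geq0$ be integers. Let $F$ be the $2^m\times2^{(t+1)m}$ matrix with rows indexed by $x\in\mathbb{F}_{2^m}$ and columns indexed by $\alpha=(\alpha_0,\alpha_1,\ldots,\alpha_t)\in\mathbb{F}_{2^m}^{t+1}$, with entries $$F_{x\alpha}=\tfrac{1}{\sqrt{2^m}}(-1)^{\mathrm{Tr}\big[\alpha_0x+\sum_{i=1}^t\alpha_ix^{2^i+1}\big]},$$ where $\mathrm{Tr}:\mathbb{F}_{2^m}\to\mathbb{F}_2$, $\mathrm{Tr}(z)=\sum_{i=0}^{m-1}z^{2^i}$, is the trace map. Then $F$ is a unit norm tight frame, i.e., $\|F\|_2^2=2^{tm}$, with worst-case coherence $\mu_F\leq\frac{1}{\sqrt{2^{m-2t-1}}}$ and average coherence $\nu_F\leq\frac{\mu_F}{\sqrt{2^m}}$.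
   Context: $\|F\|_2$ is the spectral norm. A (finite-dimensional) frame is an $M\times N$ matrix of rank $M$, whose columns are called the frame elements; it is unit norm if all columns have Euclidean norm $1$. It is tight if $\sum_{n=1}^N|\langle x,f_n\rangle|^2=A\|x\|^2$ for some $A>0$ and all $x$; for an $M\times N$ unit norm frame this is equivalent to $\|F\|_2^2=\frac{N}{M}$. For an $M\times N$ unit norm frame $F$ with columns $f_1,\ldots,f_N$, the worst-case coherence is $\mu_F:=\max_{i\neq j}|\langle f_i,f_j\rangle|$ and the average coherence is $\nu_F:=\frac{1}{N-1}\max_{i\in\{1,\ldots,N\}}\big|\sum_{j\neq i}\langle f_i,f_j\rangle\big|$, where $i,j$ range over $\{1,\ldots,N\}$. *)

(* Defs.v *)
From HB Require Import structures.
From mathcomp Require Import all_boot all_order all_fingroup all_algebra.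
From mathcomp Require Import all_solvable all_field.
From mathcomp Require Import spectral complex.
From mathcomp Require Import boolp classical_sets reals.

Set Implicit Arguments.
Unset Strict Implicit.
Unset Printing Implicit Defensive.

Import Order.TTheory GRing.Theory Num.Theory.
Local Open Scope ring_scope.
Local Open Scope complex_scope.

Section Frames.
Variable R : realType.
Implicit Types M N : nat.

(* Vectors are columns; [dotmx] is the Hermitian inner product of rows, linear
   in its first argument and conjugate-linear in the second. *)
Definition inner M (x y : 'cV[R[i]]_M) : R[i] := dotmx x^T y^T.

(* The real-valued modulus; the library's [`|z|] lives in R[i]. *)
Definition modulus (z : R[i]) : R := complex.Re `|z|.

Definition euclid_norm M (x : 'cV[R[i]]_M) : R :=
  Num.sqrt (\sum_(i < M) modulus (x i 0) ^+ 2).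

Definition spectral_norm M N (F : 'M[R[i]]_(M, N)) : R :=
  sup [set euclid_norm (F *m x) | x in [set x | euclid_norm x <= 1]]%classic.

Definition is_frame M N (F : 'M[R[i]]_(M, N)) : Prop := \rank F = M.

Definition is_unit_norm_frame M N (F : 'M[R[i]]_(M, N)) : Prop :=
  is_frame F /\ forall n, euclid_norm (col n F) = 1.

Definition is_tight_frame M N (F : 'M[R[i]]_(M, N)) : Prop :=
  is_frame F /\
  exists2 A : R, 0 < A &
    forall x, \sum_(n < N) modulus (inner x (col n F)) ^+ 2
              = A * euclid_norm x ^+ 2.

(* The maximands in both coherences are nonnegative, so the default value 0 of
   the iterated maximum only matters when the index set is empty. *)
Definition worst_case_coherence M N (F : 'M[R[i]]_(M, N)) : R :=
  \big[Num.max/0]_(p : 'I_N * 'I_N | p.1 != p.2)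
    modulus (inner (col p.1 F) (col p.2 F)).

Definition average_coherence M N (F : 'M[R[i]]_(M, N)) : R :=
  (N%:R - 1)^-1 *
  \big[Num.max/0]_(i < N)
    modulus (\sum_(j < N | j != i) inner (col i F) (col j F)).

End Frames.

Section Matrix.

(* For a field K of order 2^m this is the trace to F_2, with values in the prime
   subfield {0, 1} of K; see [trace2_01]. *)
Definition trace2 (m : nat) (K : finFieldType) (z : K) : K :=
  \sum_(i < m) z ^+ (2 ^ i).

Lemma trace2_01 (m : nat) (K : finFieldType) (z : K) :
  #|K| = (2 ^ m)%N -> trace2 m z = 0 \/ trace2 m z = 1.
Proof.
move=> cardK; have ch2 : 2%N \in [pchar K] by exact: card_finPcharP cardK _.
suff /eqP : trace2 m z * (trace2 m z - 1) = 0.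
  by rewrite mulf_eq0 subr_eq0 => /orP[] /eqP; [left | right].
rewrite mulrBr mulr1 -expr2 -(pFrobenius_autE ch2) /trace2 rmorph_sum /=.
apply/eqP; rewrite subr_eq0; apply/eqP; apply: (@addrI _ z).
have -> : \sum_(i < m) pFrobenius_aut ch2 (z ^+ (2 ^ i))
        = \sum_(i < m) z ^+ (2 ^ i.+1).
  by apply: eq_bigr => i _; rewrite pFrobenius_autE -exprM expnSr.
transitivity (\sum_(i < m.+1) z ^+ (2 ^ i)); first by rewrite big_ord_recl.
by rewrite big_ord_recr /= -cardK expf_card addrC.
Qed.

(* (-1)^(Tr z), reading Tr z in {0, 1} as an exponent. *)
Definition sign_trace (m : nat) (K : finFieldType) (S : nzRingType) (z : K) : S :=
  (-1) ^+ (trace2 m z != 0).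

(* Rows and columns are indexed by K and by K^(t+1) through the library's
   enumerations of these finite types. *)
Definition frame_matrix (R : realType) (m t : nat) (K : finFieldType) :
    'M[R[i]]_(#|K|, #|{ffun 'I_t.+1 -> K}|) :=
  \matrix_(x, a)
    let x : K := enum_val x in
    let alpha : {ffun 'I_t.+1 -> K} := enum_val a in
    ((Num.sqrt (2 ^+ m))^-1)%:C *
    sign_trace m _ (alpha ord0 * x
      + \sum_(i < t.+1 | (0 < i)%N) alpha i * x ^+ (2 ^ i + 1)).

End Matrix.

(* Main.v *)
(* The phase of column alpha is additive in alpha, and the trace character z
   |-> (-1)^Tr(z) is a nontrivial character of K, so the linear coefficient
   alpha_0 makes distinct rows orthogonal: F F^* = 2^(tm) I. This gives the
   frame property, tightness and the spectral norm.
   The inner product of the columns alpha and beta is 2^-m times the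
   exponential sum of the quadratic phase alpha - beta. The square of this
   sum is 2^m times a sum over the radical of the polar form. If a
   coefficient of index i >= 1 is nonzero, the radical is the zero set of a
   nonzero polynomial of degree at most 2^(2t), so the squared sum is at
   most 2^(m+2t); otherwise the phase is linear and nonzero, and the sum
   vanishes.
   The row x = 0 is constant, so orthogonality to the other rows shows that
   every row of the Gram matrix sums to N/M. The average coherence is
   therefore (N/M - 1)/(N - 1), and a Welch-type bound on one row of the
   Gram matrix compares it with the worst-case coherence. *)
Require Import Defs.
From HB Require Import structures.
From mathcomp Require Import all_boot all_order all_fingroup all_algebra.
From mathcomp Require Import all_solvable all_field.
From mathcomp Require Import spectral complex.
From mathcomp Require Import boolp classical_sets reals.
From mathcomp Require Import ring.

Set Implicit Arguments.
Unset Strict Implicit.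
Unset Printing Implicit Defensive.

Import Order.TTheory GRing.Theory Num.Theory.
Local Open Scope ring_scope.

(** * Exponential sums of quadratic phases *)

(** Reindexing along [h] equates the sum with its opposite, so twice the sum is 0. *)
Lemma sum_sign_reversing (S : numDomainType) (T : finType) (h : T -> T)
    (f : T -> S) :
  injective h -> (forall a, f (h a) = - f a) -> \sum_a f a = 0.
Proof.
move=> h_inj fh; apply/eqP; rewrite -[_ == 0](mulrn_eq0 _ 2) mulr2n.
rewrite {1}(reindex_inj h_inj) -big_split /=.
by apply/eqP/big1 => a _; rewrite fh addNr.
Qed.

(** * The trace character of a field of order [2 ^ m] *)

Section TraceCharacter.
Variables (m : nat) (K : finFieldType).
Hypothesis cardK : #|K| = (2 ^ m)%N.
Implicit Types x y z c : K.

Lemma pchar2_of_card : 2%N \in [pchar K].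
Proof. exact: card_finPcharP cardK _. Qed.

Lemma exprD_pow2 k x y : (x + y) ^+ (2 ^ k) = x ^+ (2 ^ k) + y ^+ (2 ^ k).
Proof.
by rewrite exprDn_pchar // pnatX (eq_pnat _ (pcharf_eq pchar2_of_card)) pnat_id.
Qed.

Lemma expr_pow2_inj k : injective (fun x => x ^+ (2 ^ k)).
Proof.
move=> x y /= exy; apply/eqP; rewrite -subr_eq0.
have: (x - y) ^+ (2 ^ k) == 0.
  by rewrite exprD_pow2 exy -exprD_pow2 subrr expr0n expn_eq0.
by rewrite expf_eq0 => /andP[].
Qed.

Lemma trace2D x y : trace2 m (x + y) = trace2 m x + trace2 m y.
Proof. by rewrite -big_split; apply: eq_bigr => i _; rewrite exprD_pow2. Qed.

(** Squaring shifts the exponents by one; the new last term [z ^+ (2 ^ m)] is [z], the old first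
    one. *)
Lemma trace2_sqr z : trace2 m (z ^+ 2) = trace2 m z.
Proof.
rewrite /trace2; apply: (@addrI _ z).
transitivity (\sum_(i < m.+1) z ^+ (2 ^ i)).
  rewrite big_ord_recl; congr (_ + _).
  by apply: eq_bigr => i _; rewrite -exprM expnS.
by rewrite big_ord_recr /= -cardK expf_card addrC.
Qed.

Lemma trace2_pow2 k z : trace2 m (z ^+ (2 ^ k)) = trace2 m z.
Proof. by elim: k => [|k IH] //; rewrite expnSr exprM trace2_sqr. Qed.

(** The trace is a polynomial function of degree [2 ^ (m - 1)], too small to vanish at all [2 ^ m]
    elements, and its values are 0 or 1. *)
Lemma trace2_surj : exists z, trace2 m z = 1.
Proof.
have m_gt0 : (0 < m)%N.
  by case: m cardK (finNzRing_gt1 K) => // ->.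
case: m m_gt0 cardK => // k _ cardK'.
pose p : {poly K} := \sum_(i < k.+1) 'X^(2 ^ i).
have sz_p : size p = (2 ^ k).+1.
  rewrite /p big_ord_recr /= addrC size_polyDl size_polyXn // ltnS.
  apply: (leq_trans (size_sum _ _ _)); apply/bigmax_leqP => i _.
  by rewrite size_polyXn ltn_exp2l.
have p_neq0 : p != 0 by rewrite -size_poly_eq0 sz_p.
have hp z : p.[z] = trace2 k.+1 z.
  by rewrite horner_sum; apply: eq_bigr => i _; rewrite hornerXn.
case: (pickP (fun z => trace2 k.+1 z != 0)) => [z nz|all0].
  by exists z; case: (trace2_01 z cardK') nz => ->; rewrite ?eqxx.
have: (size (enum K) < size p)%N.
  apply: max_poly_roots; rewrite ?enum_uniq //; apply/allP => z _.
  by rewrite /root hp; move/negbFE: (all0 z).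
by rewrite -cardE cardK' sz_p ltnS leq_exp2l // ltnn.
Qed.

Section Values.
Variable S : numDomainType.
Local Notation chi := (@sign_trace m K S).

Lemma sign_trace0 : chi 0 = 1.
Proof.
rewrite /sign_trace /trace2 big1 ?eqxx // => i _.
by rewrite expr0n expn_eq0.
Qed.

Lemma sign_traceD x y : chi (x + y) = chi x * chi y.
Proof.
rewrite /sign_trace trace2D -signr_addb; congr (_ ^+ nat_of_bool _).
case: (trace2_01 x cardK) (trace2_01 y cardK) => -> [->|->];
  by rewrite ?addr0 ?add0r ?(addrr_pchar2 pchar2_of_card) ?eqxx ?oner_eq0.
Qed.

Lemma sign_traceN x : chi (- x) = chi x.
Proof. by rewrite (oppr_pchar2 pchar2_of_card). Qed.

Lemma sign_trace_sqr x : chi x * chi x = 1.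
Proof. by rewrite -expr2 sqrr_sign. Qed.

Lemma normr_sign_trace x : `|chi x| = 1.
Proof. exact: normr_sign. Qed.

Lemma sign_trace_eqN1 : exists z, chi z = -1.
Proof.
by have [z tz] := trace2_surj; exists z; rewrite /sign_trace tz oner_eq0.
Qed.

(** For [c != 0], translation by [c^-1 * z] with [chi z = -1] reverses every sign. *)
Lemma sum_sign_trace_mul c :
  \sum_x chi (c * x) = if c == 0 then (2 ^ m)%:R else 0.
Proof.
case: eqP => [->|/eqP c0].
  under eq_bigr do rewrite mul0r sign_trace0.
  by rewrite sumr_const cardK.
have [z chiz] := sign_trace_eqN1.
apply: (@sum_sign_reversing _ _ (+%R (c^-1 * z))) => [|x]; first exact: addrI.
by rewrite mulrDr mulrA divff // mul1r sign_traceD chiz mulN1r.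
Qed.

End Values.
End TraceCharacter.

(** * Quadratic phases and their polarization *)

Section Phase.
Variables (m : nat) (K : finFieldType) (t : nat).
Hypothesis cardK : #|K| = (2 ^ m)%N.
Implicit Types (x y : K) (a b : {ffun 'I_t.+1 -> K}).

Definition phase a x : K :=
  a ord0 * x + \sum_(i < t.+1 | (0 < i)%N) a i * x ^+ (2 ^ i + 1).

Lemma phaseD a b x : phase (a + b) x = phase a x + phase b x.
Proof.
rewrite /phase ffunE mulrDl addrACA -big_split; congr (_ + _).
by apply: eq_bigr => i _; rewrite ffunE mulrDl.
Qed.

Lemma phaseN a x : phase (- a) x = - phase a x.
Proof.
rewrite /phase ffunE mulNr opprD -sumrN; congr (_ + _).
by apply: eq_bigr => i _; rewrite ffunE mulNr.
Qed.

Lemma phase0r a : phase a 0 = 0.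
Proof.
rewrite /phase mulr0 add0r big1 // => i _.
by rewrite expr0n addn1 mulr0.
Qed.

(** Since [x ^+ (2 ^ i)] is additive in [x], the cross terms of [x ^+ (2 ^ i + 1)] form a polar
    form. *)
Lemma phase_arg_add a x y :
  phase a (x + y) = phase a x + phase a y
    + \sum_(i < t.+1 | (0 < i)%N) a i * (x ^+ (2 ^ i) * y + x * y ^+ (2 ^ i)).
Proof.
rewrite /phase mulrDr [in RHS]addrACA -[RHS]addrA -!big_split /=; congr (_ + _).
apply: eq_bigr => i _; rewrite !addn1 !exprSr (exprD_pow2 cardK); ring.
Qed.

(* Applying Frobenius to each term of the polarization, under the trace, turns
   it into [radical_poly a].[x] * y ^+ 2 ^ t: no inverse Frobenius is needed. *)
Definition radical_poly a : {poly K} :=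
  \sum_(i < t.+1 | (0 < i)%N)
    ((a i ^+ (2 ^ t)) *: 'X^(2 ^ (t + i))
     + (a i ^+ (2 ^ (t - i))) *: 'X^(2 ^ (t - i))).

Lemma trace2_polar a x y :
  trace2 m (\sum_(i < t.+1 | (0 < i)%N)
              a i * (x ^+ (2 ^ i) * y + x * y ^+ (2 ^ i)))
  = trace2 m ((radical_poly a).[x] * y ^+ (2 ^ t)).
Proof.
have tr0 : trace2 m (0 : K) = 0.
  by rewrite /trace2 big1 // => i _; rewrite expr0n expn_eq0.
rewrite horner_sum mulr_suml !(big_morph _ (trace2D cardK) tr0).
apply: eq_bigr => i _; rewrite !hornerE mulrDl mulrDr.
rewrite !(trace2D cardK); congr (_ + _).
  (* This term is raised to the power [2 ^ t], the next one to [2 ^ (t - i)]; both then end in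
     [y ^+ (2 ^ t)]. *)
  by rewrite -[LHS](trace2_pow2 cardK t) !exprMn -exprM -expnD addnC mulrA.
rewrite -[LHS](trace2_pow2 cardK (t - i)) !exprMn -exprM -expnD.
by rewrite subnKC ?mulrA // -ltnS ltn_ord.
Qed.

Lemma size_radical_poly a : (size (radical_poly a) <= (2 ^ (2 * t)).+1)%N.
Proof.
apply: (leq_trans (size_sum _ _ _)); apply/bigmax_leqP => i _.
apply: (leq_trans (size_polyD _ _)); rewrite geq_max.
have le_it : (i <= t)%N by rewrite -ltnS.
rewrite !(leq_trans (size_scale_leq _ _)) // size_polyXn ltnS leq_exp2l //.
  by rewrite (leq_trans (leq_subr _ _)) // leq_pmull.
by rewrite mul2n -addnn leq_add2l.
Qed.

(** The exponents [t + j] are distinct and [t + i] exceeds every [t - j], so the coefficient at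
    [2 ^ (t + i)] is just [a i ^+ (2 ^ t)]. *)
Lemma radical_poly_neq0 a (i : 'I_t.+1) :
  (0 < i)%N -> a i != 0 -> radical_poly a != 0.
Proof.
move=> i_gt0 ai0.
have lt_exp (k l : nat) : (0 < l)%N -> (t - k < t + l)%N.
  move=> l0; rewrite (leq_ltn_trans (leq_subr _ _)) //.
  by rewrite -{1}[t]addn0 ltn_add2l.
apply/eqP => /(congr1 (fun p : {poly K} => p`_(2 ^ (t + i)))).
rewrite coef0 coef_sum (bigD1 i) //= big1 ?addr0 => [|j /andP[j_gt0 ji]].
  rewrite coefD !coefZ !coefXn eqxx mulr1 eqn_exp2l //.
  rewrite gtn_eqF ?lt_exp // mulr0 addr0.
  by move/eqP; rewrite expf_eq0 (negbTE ai0) andbF.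
rewrite coefD !coefZ !coefXn !eqn_exp2l // eqn_add2l.
rewrite [(i == j :> nat)]eq_sym val_eqE (negbTE ji) mulr0 add0r.
by rewrite gtn_eqF ?lt_exp ?mulr0.
Qed.

Section ExponentialSum.
Variable S : numDomainType.
Local Notation chi := (@sign_trace m K S).

(** Substituting [x + y] for [x] in the double sum leaves, for each [x], a character sum over [y]
    that vanishes off the radical. *)
Lemma sqr_sum_sign_phase a :
  (\sum_x chi (phase a x)) ^+ 2
  = (2 ^ m)%:R * \sum_(x | root (radical_poly a) x) chi (phase a x).
Proof.
rewrite expr2 mulr_suml.
transitivity (\sum_x \sum_y chi (phase a (x + y)) * chi (phase a y)).
  rewrite exchange_big /=; under [LHS]eq_bigr do rewrite mulr_sumr.
  rewrite exchange_big; apply: eq_bigr => y _.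
  by rewrite (reindex_inj (addIr y)).
rewrite mulr_sumr [RHS]big_mkcond; apply: eq_bigr => x _ /=.
transitivity (chi (phase a x)
              * \sum_y chi ((radical_poly a).[x] * y ^+ (2 ^ t))).
  rewrite mulr_sumr; apply: eq_bigr => y _.
  rewrite phase_arg_add 2!(sign_traceD cardK) mulrAC -(mulrA (chi (phase a x))).
  rewrite sign_trace_sqr mulr1; congr (_ * _).
  by rewrite /sign_trace trace2_polar.
(* The map [y ^+ (2 ^ t)] permutes [K], so the sum over [y] is a full linear character sum. *)
have := sum_sign_trace_mul cardK S (radical_poly a).[x].
rewrite (reindex_inj (expr_pow2_inj cardK (k := t))) /= /root => ->.
by case: eqP => _; rewrite ?mulr0 // mulrC.
Qed.

Lemma norm_sum_sign_phase a :
  a != 0 -> `|\sum_x chi (phase a x)| ^+ 2 <= 2 ^+ (m + 2 * t).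
Proof.
move=> a_neq0.
case: (pickP (fun i : 'I_t.+1 => (0 < i)%N && (a i != 0)))
  => [i /andP[i0 ai]|a0].
  (* With a nonzero quadratic coefficient, the sum over the radical is at most its number of
     roots. *)
  rewrite -normrX sqr_sum_sign_phase normrM normr_nat natrX exprD.
  rewrite ler_pM2l ?exprn_gt0 //.
  apply: (le_trans (ler_norm_sum _ _ _)).
  under eq_bigr do rewrite normr_sign_trace.
  rewrite sumr_const -natrX ler_nat -ltnS cardE.
  apply: leq_trans (size_radical_poly a).
  apply: max_poly_roots (radical_poly_neq0 i0 ai) _ (enum_uniq _).
  by apply/allP => x; rewrite mem_enum.
(* Here the phase is linear, and [a != 0] forces its coefficient to be nonzero. *)
have phaseE x : phase a x = a ord0 * x.
  rewrite /phase big1 ?addr0 // => i i0; move: (a0 i); rewrite i0 /=.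
  by move/negbFE/eqP->; rewrite mul0r.
under eq_bigr do rewrite phaseE.
rewrite (sum_sign_trace_mul cardK) ifN ?normr0 ?expr0n ?exprn_ge0 //.
apply: contraNneq a_neq0 => a00; apply/eqP/ffunP => i; rewrite ffunE.
have [i0|i0] := posnP i; last by move: (a0 i); rewrite i0 => /negbFE/eqP.
by rewrite -a00; congr (a _); apply: val_inj.
Qed.

Lemma sum_sign_phase_mul x y :
  \sum_a chi (phase a x) * chi (phase a y)
  = if x == y then (2 ^ (t.+1 * m))%:R else 0.
Proof.
case: eqP => [->|/eqP xy].
  under eq_bigr do rewrite sign_trace_sqr.
  by rewrite sumr_const card_ffun card_ord cardK -expnM mulnC.
have [z chiz] := sign_trace_eqN1 cardK S.
(* A purely linear phase with [phase b x - phase b y = z], so translation by [b] reverses the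
   sign. *)
pose b : {ffun 'I_t.+1 -> K} :=
  [ffun i => if i == ord0 then z / (x - y) else 0].
have phase_b u : phase b u = z / (x - y) * u.
  rewrite /phase ffunE eqxx big1 ?addr0 // => i i0.
  by rewrite ffunE -val_eqE /= gtn_eqF ?mul0r.
apply: (@sum_sign_reversing _ _ (+%R b)) => [|a]; first exact: addrI.
rewrite !phaseD 2!(sign_traceD cardK) mulrACA.
rewrite -(sign_traceN cardK _ (phase b y)).
rewrite -(sign_traceD cardK _ (phase b x)) !phase_b.
by rewrite -mulrBr divfK ?subr_eq0 // chiz mulN1r.
Qed.

End ExponentialSum.
End Phase.

(** * Frames with scalar Gram operator *)

Section InnerProduct.
Local Open Scope complex_scope.
Local Open Scope sesquilinear_scope.
Variable R : realType.
Implicit Types z : R[i].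

Lemma modulusE z : (modulus z)%:C = `|z|.
Proof. by rewrite RRe_real // normr_real. Qed.

Lemma modulus_ge0 z : 0 <= modulus z.
Proof. by rewrite -ler0c modulusE. Qed.

Lemma modulus_sqr z : (modulus z ^+ 2)%:C = z * z^*%R.
Proof. by rewrite rmorphXn /= modulusE normCK. Qed.

Lemma modulus_real (r : R) : 0 <= r -> modulus r%:C = r.
Proof. by move=> r0; apply: complexI; rewrite modulusE ger0_norm ?ler0c. Qed.

Section Vectors.
Variable M : nat.
Implicit Types x y : 'cV[R[i]]_M.

Lemma innerE x y : inner x y = (y ^t* *m x) 0 0.
Proof.
rewrite /inner dotmxE trmxK !mxE; apply: eq_bigr => i _.
by rewrite !mxE mulrC.
Qed.

Lemma innerBl x1 x2 y : inner (x1 - x2) y = inner x1 y - inner x2 y.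
Proof. by rewrite !innerE mulmxBr !mxE. Qed.

Lemma innerZl c x y : inner (c *: x) y = c * inner x y.
Proof. by rewrite !innerE -scalemxAr !mxE. Qed.

Lemma inner_conj x y : (inner x y)^*%R = inner y x.
Proof.
rewrite !innerE !mxE rmorph_sum; apply: eq_bigr => i _.
by rewrite !mxE rmorphM /= conjCK mulrC.
Qed.

Lemma innerBr x y1 y2 : inner x (y1 - y2) = inner x y1 - inner x y2.
Proof. by rewrite -inner_conj innerBl rmorphB /= !inner_conj. Qed.

Lemma innerZr c x y : inner x (c *: y) = c^*%R * inner x y.
Proof. by rewrite -inner_conj innerZl rmorphM /= inner_conj. Qed.

Lemma euclid_norm_ge0 x : 0 <= euclid_norm x.
Proof. exact: sqrtr_ge0. Qed.

Lemma euclid_norm_sqr x : euclid_norm x ^+ 2 = \sum_i modulus (x i 0) ^+ 2.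
Proof. by rewrite sqr_sqrtr // sumr_ge0 // => i _; rewrite sqr_ge0. Qed.

Lemma inner_self x : inner x x = (euclid_norm x ^+ 2)%:C.
Proof.
rewrite innerE euclid_norm_sqr mxE rmorph_sum; apply: eq_bigr => i _.
by rewrite !mxE mulrC -modulus_sqr.
Qed.

End Vectors.

Lemma inner_adjoint M N (A : 'M[R[i]]_(M, N)) x y :
  inner (A *m x) y = inner x (A ^t* *m y).
Proof. by rewrite !innerE trmx_mul map_mxM /= trmxCK mulmxA. Qed.

End InnerProduct.

(** * Consequences of a scalar [F F^*] *)

Section TightFrame.
Local Open Scope complex_scope.
Local Open Scope sesquilinear_scope.
Variables (R : realType) (M N : nat) (F : 'M[R[i]]_(M, N)) (a : R).
Hypotheses (a_gt0 : 0 < a) (FFadj : F *m F ^t* = a%:C%:M).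

Lemma euclid_norm_adjoint x :
  euclid_norm (F ^t* *m x) ^+ 2 = a * euclid_norm x ^+ 2.
Proof.
apply: complexI; rewrite -inner_self inner_adjoint trmxCK mulmxA FFadj.
rewrite mul_scalar_mx innerZr inner_self [RHS](rmorphM _ a) /=; congr (_ * _).
by rewrite conj_Creal // complex_real.
Qed.

(** The inner products of [x] with the columns are the entries of [F ^t* *m x]. *)
Lemma sum_sqr_inner_col x :
  \sum_(n < N) modulus (inner x (col n F)) ^+ 2 = a * euclid_norm x ^+ 2.
Proof.
rewrite -euclid_norm_adjoint euclid_norm_sqr; apply: eq_bigr => n _.
congr (modulus _ ^+ 2); rewrite innerE !mxE; apply: eq_bigr => i _.
by rewrite !mxE.
Qed.

Lemma scalar_gram_rank : \rank F = M.
Proof.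
apply/eqP; rewrite eqn_leq rank_leq_row /=.
have aC_neq0 : a%:C != 0 by rewrite (fmorph_eq0 (real_complex R)) gt_eqF.
rewrite -[X in (X <= _)%N](mxrank1 R[i] M) -(mxrank_scale_nz 1%:M aC_neq0).
by rewrite scalemx1 -FFadj mxrankM_maxl.
Qed.

Lemma scalar_gram_tight : is_tight_frame F.
Proof.
by split; [exact: scalar_gram_rank | exists a; last exact: sum_sqr_inner_col].
Qed.

(* Expanding 0 <= |a x - F^* F x|^2. *)
Lemma euclid_norm_mul_le x :
  euclid_norm (F *m x) ^+ 2 <= a * euclid_norm x ^+ 2.
Proof.
set G := F ^t* *m (F *m x).
have a_conj : (a%:C)^*%R = a%:C by rewrite conj_Creal // complex_real.
have Gx : inner G x = (euclid_norm (F *m x) ^+ 2)%:C.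
  by rewrite -inner_self /G (inner_adjoint (F ^t*)) trmxCK.
have xG : inner x G = (euclid_norm (F *m x) ^+ 2)%:C.
  by rewrite -inner_self /G -(inner_adjoint F x).
have: 0 <= euclid_norm (a%:C *: x - G) ^+ 2 by rewrite sqr_ge0.
suff -> : euclid_norm (a%:C *: x - G) ^+ 2
        = a * (a * euclid_norm x ^+ 2 - euclid_norm (F *m x) ^+ 2).
  by rewrite pmulr_rge0 // subr_ge0.
apply: complexI; rewrite -inner_self innerBl !innerBr !innerZl !innerZr a_conj.
rewrite Gx xG !inner_self euclid_norm_adjoint !(rmorphM, rmorphB) /=.
by ring.
Qed.

Lemma scalar_gram_spectral_norm : (0 < M)%N -> spectral_norm F ^+ 2 = a.
Proof.
move=> M_gt0; have a_ge0 := ltW a_gt0.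
have sa_gt0 : 0 < Num.sqrt a by rewrite sqrtr_gt0.
have sa_ge0 := ltW sa_gt0.
suff -> : spectral_norm F = Num.sqrt a by rewrite sqr_sqrtr.
have norm_le x : euclid_norm x <= 1 -> euclid_norm (F *m x) <= Num.sqrt a.
  move=> x1; rewrite -(ler_pXn2r (n := 2)) ?nnegrE ?euclid_norm_ge0 //.
  rewrite (sqr_sqrtr a_ge0); apply: le_trans (euclid_norm_mul_le x) _.
  by rewrite ler_piMr // expr_le1 ?euclid_norm_ge0.
have ub : ubound
    [set euclid_norm (F *m x) | x in [set x | euclid_norm x <= 1]]%classic
    (Num.sqrt a) by move=> _ [x x1 <-]; exact: norm_le.
pose e : 'cV[R[i]]_M := delta_mx (Ordinal M_gt0) 0.
have e1 : euclid_norm e ^+ 2 = 1.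
  rewrite euclid_norm_sqr (bigD1 (Ordinal M_gt0)) //= big1 => [|i /negbTE ni].
    by rewrite mxE !eqxx (modulus_real ler01) expr1n addr0.
  by rewrite mxE ni (modulus_real (lexx 0)) expr0n.
(* The maximizer: it has norm 1, and [F] maps it to [e] scaled by [Num.sqrt a]. *)
pose x := (Num.sqrt a)^-1%:C *: (F ^t* *m e).
have normZ r n (y : 'cV[R[i]]_n) :
    euclid_norm (r%:C *: y) ^+ 2 = r ^+ 2 * euclid_norm y ^+ 2.
  apply: complexI; rewrite -inner_self innerZl innerZr inner_self.
  rewrite conj_Creal ?complex_real //.
  rewrite mulrA -expr2 -(rmorphXn (real_complex R)).
  by rewrite -(rmorphM (real_complex R)).
have x1 : euclid_norm x <= 1.
  rewrite -(expr_le1 (n := 2)) ?euclid_norm_ge0 //.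
  rewrite normZ euclid_norm_adjoint e1 mulr1 exprVn sqr_sqrtr //.
  by rewrite mulVf // gt_eqF.
apply/le_anti/andP; split.
  by apply: ge_sup ub; exists (euclid_norm (F *m x)), x.
apply: ub_le_sup; first by exists (Num.sqrt a).
exists x => //; apply/eqP; rewrite -(eqrXn2 (n := 2)) ?euclid_norm_ge0 //.
have sa_inv : (Num.sqrt a)^-1 * a = Num.sqrt a.
  by rewrite -[X in _ * X](sqr_sqrtr a_ge0) expr2 mulKf // gt_eqF.
rewrite /x -scalemxAr mulmxA FFadj mul_scalar_mx scalerA -rmorphM normZ.
by rewrite e1 mulr1 sa_inv.
Qed.

(** By orthogonality to the constant row, all other rows sum to 0, so only row [x0] contributes. *)
Lemma sum_inner_col_constant_row (x0 : 'I_M) (c : R[i]) (i : 'I_N) :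
  c != 0 -> (forall j, F x0 j = c) -> \sum_j inner (col i F) (col j F) = a%:C.
Proof.
move=> c0 Fx0.
have row_sum x : \sum_j (F x j)^*%R = (a%:C / c) *+ (x == x0).
  have /(congr1 (fun A : 'M_M => A x0 x)) := FFadj.
  rewrite !mxE eq_sym => FF; rewrite mulrC -mulrnAr -FF.
  rewrite mulr_sumr; apply: eq_bigr => j _.
  by rewrite !mxE Fx0 mulKf.
transitivity (\sum_x F x i * \sum_j (F x j)^*%R).
  under [RHS]eq_bigr do rewrite mulr_sumr.
  rewrite [RHS]exchange_big; apply: eq_bigr => j _.
  by rewrite innerE mxE; apply: eq_bigr => x _; rewrite !mxE mulrC.
rewrite (bigD1 x0) //= row_sum eqxx big1 => [|x /negbTE nx]; last first.
  by rewrite row_sum nx mulr0.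
by rewrite addr0 Fx0 mulrC divfK.
Qed.

Hypothesis col1 : forall n, euclid_norm (col n F) = 1.

Lemma worst_case_coherence_ge0 : 0 <= worst_case_coherence F.
Proof. exact: bigmax_ge_id. Qed.

(** Tightness at [col i F]: the squared moduli sum to [a], the diagonal one is 1, and the coherence
    bounds the other [N - 1]. *)
Lemma welch_row (i : 'I_N) :
  a - 1 <= (N%:R - 1) * worst_case_coherence F ^+ 2.
Proof.
have := sum_sqr_inner_col (col i F).
rewrite col1 expr1n mulr1 (bigD1 i) //= inner_self col1 expr1n.
rewrite (modulus_real ler01) expr1n => <-; rewrite [X in X <= _]addrC addKr.
have -> : N%:R - 1 = #|predC1 i|%:R :> R.
  rewrite cardC1 card_ord -[N in LHS](@prednK N) ?mulrSr ?addrK //.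
  exact: leq_ltn_trans (ltn_ord i).
rewrite mulr_natl -sumr_const ler_sum // => j ji.
rewrite ler_pXn2r ?nnegrE ?modulus_ge0 ?worst_case_coherence_ge0 //.
apply: (@le_bigmax_cond _ _ _ 0 (i, j) (fun p => p.1 != p.2)
         (fun p => modulus (inner (col p.1 F) (col p.2 F)))).
by rewrite eq_sym.
Qed.

(** After squaring, [welch_row] reduces the claim to [(a - 1) * M <= N - 1], that is
    [N - M <= N - 1]. *)
Lemma average_coherence_constant_row (x0 : 'I_M) (c : R[i]) :
  c != 0 -> (forall j, F x0 j = c) -> (1 < N)%N -> a * M%:R = N%:R ->
  1 <= a ->
  average_coherence F <= worst_case_coherence F / Num.sqrt M%:R.
Proof.
move=> c0 Fx0 N_gt1 aM a_ge1.
set mu := worst_case_coherence F.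
have N1_gt0 : 0 < N%:R - 1 :> R by rewrite subr_gt0 ltr1n.
have M_gt0 : 0 < M%:R :> R.
  by rewrite -(pmulr_rgt0 _ a_gt0) aM ltr0n (ltn_trans _ N_gt1).
have -> : average_coherence F = (N%:R - 1)^-1 * (a - 1).
  congr (_ * _); have a1 : 0 <= a - 1 by rewrite subr_ge0.
  have term i :
      modulus (\sum_(j < N | j != i) inner (col i F) (col j F)) = a - 1.
    have := sum_inner_col_constant_row i c0 Fx0.
    rewrite (bigD1 i) //= inner_self col1 expr1n => sum_eq.
    by rewrite -[RHS]modulus_real // rmorphB /= -sum_eq [X in X - _]addrC addrK.
  under eq_bigr do rewrite term.
  (* All maximands equal [a - 1 >= 0] and the index set is nonempty, so the default 0 is
     harmless. *)
  by rewrite (bigmax_eq_arg _ (Ordinal (ltnW N_gt1))).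
have lhs_ge0 : 0 <= (N%:R - 1)^-1 * (a - 1) * Num.sqrt M%:R.
  by rewrite !mulr_ge0 ?sqrtr_ge0 ?invr_ge0 ?subr_ge0 // -subr_ge0 ltW.
rewrite ler_pdivlMr ?sqrtr_gt0 //.
rewrite -(ler_pXn2r (ltn0Sn 1)) ?nnegrE //; last first.
  exact: worst_case_coherence_ge0.
have i0 := Ordinal (ltnW N_gt1).
rewrite -(ler_pM2l N1_gt0); apply: le_trans (welch_row i0).
rewrite exprMn (sqr_sqrtr (ltW M_gt0)) exprMn.
have -> : (N%:R - 1) * ((N%:R - 1)^-1 ^+ 2 * (a - 1) ^+ 2 * M%:R)
    = (a - 1) * (((a - 1) * M%:R) / (N%:R - 1)).
  by field; rewrite gt_eqF.
rewrite ler_piMr ?subr_ge0 // ler_pdivrMr // mul1r mulrBl aM mul1r lerD2l lerN2.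
by rewrite ler1n -(ltr0n R).
Qed.

End TightFrame.

(** * The frame matrix *)

Section FrameMatrix.
Local Open Scope complex_scope.
Variables (R : realType) (m t : nat) (K : finFieldType).
Hypothesis cardK : #|K| = (2 ^ m)%N.
Local Notation F := (frame_matrix R m t K).
Local Notation chi := (@sign_trace m K R[i]).
Local Notation scale := ((Num.sqrt (2 ^+ m : R))^-1)%:C.

Lemma frame_matrixE x j :
  F x j = scale * chi (phase (enum_val j) (enum_val x)).
Proof. by rewrite mxE. Qed.

Lemma conj_sign_trace z : (chi z)^*%R = chi z.
Proof. by rewrite rmorphXn rmorphN1. Qed.

Lemma scale_conj : scale^*%R = scale.
Proof. by rewrite conj_Creal // complex_real. Qed.

Lemma scale_sqr : scale * scale = (2 ^+ m)^-1.
Proof.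
rewrite -rmorphM -expr2 exprVn sqr_sqrtr ?exprn_ge0 //.
by rewrite fmorphV rmorphXn rmorph_nat.
Qed.

Lemma frame_matrix_gram : F *m (F ^t*)%sesqui = (2 ^+ (t * m))%:C%:M.
Proof.
apply/matrixP => x y; rewrite !mxE.
pose f (a : {ffun 'I_t.+1 -> K}) :=
  chi (phase a (enum_val x)) * chi (phase a (enum_val y)).
transitivity (scale * scale * \sum_(j < #|{ffun 'I_t.+1 -> K}|) f (enum_val j)).
  rewrite mulr_sumr; apply: eq_bigr => j _.
  by rewrite !mxE rmorphM /= scale_conj conj_sign_trace mulrACA.
rewrite -(big_enum_val f) /=.
rewrite (sum_sign_phase_mul t cardK) (inj_eq enum_val_inj) scale_sqr.
case: eqP => _; last by rewrite mulr0.
rewrite mulSn natrX exprD mulKf ?expf_neq0 ?pnatr_eq0 //.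
by rewrite mulr1n rmorphXn rmorph_nat.
Qed.

(** The phase is additive and the signs are real, so only the difference of the coefficient vectors
    matters. *)
Lemma inner_col_frame_matrix i j :
  inner (col i F) (col j F)
  = (2 ^+ m)^-1 * \sum_x chi (phase (enum_val i - enum_val j) x).
Proof.
rewrite (big_enum_val (fun z : K => chi (phase _ z))) innerE mxE -scale_sqr.
rewrite mulr_sumr; apply: eq_bigr => x _.
rewrite phaseD phaseN (sign_traceD cardK) (sign_traceN cardK).
rewrite !mxE rmorphM /= scale_conj conj_sign_trace mulrACA; congr (_ * _).
exact: mulrC.
Qed.

Lemma euclid_norm_col_frame_matrix i : euclid_norm (col i F) = 1.
Proof.
apply/eqP; rewrite -(eqrXn2 (n := 2)) ?euclid_norm_ge0 // expr1n; apply/eqP.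
apply: complexI; rewrite -inner_self inner_col_frame_matrix.
under eq_bigr do rewrite phaseD phaseN subrr sign_trace0.
by rewrite sumr_const cardK natrX mulVf // expf_neq0 // pnatr_eq0.
Qed.

Lemma frame_matrix_zero_row j : F (enum_rank 0) j = scale.
Proof. by rewrite frame_matrixE enum_rankK phase0r sign_trace0 mulr1. Qed.

(** The exponent is an integer since [m < 2 * t + 1] is allowed. The exponential sum bounds the
    squared coherence by [2 ^ (2 * t - m)], half of the square of the stated bound. *)
Lemma worst_case_coherence_frame_matrix :
  worst_case_coherence F <= 1 / Num.sqrt ((2 : R) ^ (m%:Z - 2 * t%:Z - 1)).
Proof.
apply: bigmax_le => [|[i j] /= ij]; first by rewrite divr_ge0 ?sqrtr_ge0.
have b_gt0 : 0 < (2 : R) ^ (m%:Z - 2 * t%:Z - 1) by rewrite exprz_gt0.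
have rhs_ge0 : 0 <= 1 / Num.sqrt ((2 : R) ^ (m%:Z - 2 * t%:Z - 1)).
  by rewrite divr_ge0 ?sqrtr_ge0.
rewrite -(ler_pXn2r (ltn0Sn 1)) ?nnegrE ?modulus_ge0 //.
rewrite div1r exprVn (sqr_sqrtr (ltW b_gt0)).
have a_neq0 : enum_val i - enum_val j != 0 :> {ffun 'I_t.+1 -> K}.
  by rewrite subr_eq0 (inj_eq enum_val_inj).
apply: (@le_trans _ _ ((2 ^+ m)^-1 ^+ 2 * 2 ^+ (m + 2 * t))).
  rewrite -lecR rmorphXn /= modulusE inner_col_frame_matrix normrM exprMn.
  rewrite normfV normrX normr_nat.
  rewrite !(rmorphM, rmorphXn, fmorphV, rmorph_nat) /=.
  by rewrite ler_pM2l ?exprn_gt0 ?invr_gt0 ?exprn_gt0 // norm_sum_sign_phase.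
rewrite -[leRHS]mul1r ler_pdivlMr // -PoszM !expfzDr ?pnatr_eq0 //.
rewrite -!exprnN -exprnP exprD expr1.
have -> : (2 ^+ m)^-1 ^+ 2 * (2 ^+ m * 2 ^+ (2 * t))
    * (2 ^+ m * 2 ^- (2 * t) * 2^-1) = 2^-1 :> R.
  by field; rewrite !expf_neq0 ?pnatr_eq0.
by rewrite invf_le1 ?ler1n ?ltr0n.
Qed.

End FrameMatrix.

Theorem theorem4 (R : realType) (m t : nat) (K : finFieldType)
    (hm : (1 <= m)%N) (hK : #|K| = (2 ^ m)%N) :
  let F := frame_matrix R m t K in
  [/\ is_unit_norm_frame F,
      is_tight_frame F,
      spectral_norm F ^+ 2 = 2 ^+ (t * m),
      worst_case_coherence F
        <= 1 / Num.sqrt ((2 : R) ^ (m%:Z - 2 * t%:Z - 1))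
    & average_coherence F <= worst_case_coherence F / Num.sqrt (2 ^+ m)].
Proof.
move=> F.
have a_gt0 : 0 < 2 ^+ (t * m) :> R by rewrite exprn_gt0.
have gram := frame_matrix_gram R t hK.
have cardN : #|{ffun 'I_t.+1 -> K}| = (2 ^ (t.+1 * m))%N.
  by rewrite card_ffun card_ord hK -expnM mulnC.
split.
- split; first exact: scalar_gram_rank gram.
  exact: euclid_norm_col_frame_matrix.
- exact: scalar_gram_tight gram.
- by apply: scalar_gram_spectral_norm gram _; rewrite // hK expn_gt0.
- exact: worst_case_coherence_frame_matrix.
have -> : 2 ^+ m = #|K|%:R :> R by rewrite hK natrX.
(* Here [1 <= m] makes the denominator [N - 1] positive. *)
have N_gt1 : (1 < #|{ffun 'I_t.+1 -> K}|)%N.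
  by rewrite cardN -[1%N](expn0 2) ltn_exp2l // muln_gt0.
have col1 := @euclid_norm_col_frame_matrix R m t K hK.
apply: (average_coherence_constant_row a_gt0 gram col1 _
          (@frame_matrix_zero_row R m t K)) => //.
- by rewrite (fmorph_eq0 (real_complex R)) invr_eq0 sqrtr_eq0 -ltNge exprn_gt0.
- by rewrite cardN hK !natrX -exprD -mulSnr.
- by rewrite exprn_ege1 // ler1n.
Qed.
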